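(* Let $({\bf H}^n,{\bf E}^n)_{0\le n\le M}$ be the solution of the scheme $$\mu\,\frac{{\bf H}^{n+1}-{\bf H}^n}{\tau}=-\hat{\bf D}\,\frac{{\bf E}^{n+1}+{\bf E}^n}{2},\qquad \epsilon\,\frac{{\bf E}^{n+1}-{\bf E}^n}{\tau}=\hat{\bf D}\,\frac{{\bf H}^{n+1}+{\bf H}^n}{2},\qquad n=0,\dots,M-1 .$$ Then the discrete symplectic conservation law holds: $$\omega^{n+1}=\omega^n,\qquad \omega^n=d{\bf E}^n\wedge d{\bf H}^n,\qquad n=0,\dots,M-1,$$ where $d{\bf E}^n\wedge d{\bf H}^n=\sum_{w\in\{x,y,z\}}d{\bf E}_w^n\wedge d{\bf H}_w^n$ and $d{\bf E}_w^n\wedge d{\bf H}_w^n=\sum_{j,k,m}dE_{w_{j,k,m}}^n\wedge dH_{w_{j,k,m}}^n$.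
   Context: Grid: $N_x,N_y,N_z$ are even positive integers, the domain is $[x_L,x_R]\times[y_L,y_R]\times[z_L,z_R]$, $L_w=w_R-w_L$, $h_w=L_w/N_w$, $\mu_w=2\pi/L_w$ for $w\in\{x,y,z\}$; $w_j=w_L+(j-1)h_w$, $j=1,\dots,N_w$. Time step $\tau=T/M$, $T>0$, $M$ a positive integer. $\epsilon,\mu>0$ are constants and $c=1/\sqrt{\epsilon\mu}$. Put $s_1=N_xN_yN_z$. ${\bf D}_1^w\in\mathbb R^{N_w\times N_w}$ is the Fourier spectral first-order differentiation matrix: $({\bf D}_1^w)_{j,l}=\tfrac12\mu_w(-1)^{j+l}\cot\big(\mu_w\tfrac{w_j-w_l}{2}\big)$ for $j\ne l$, and $({\bf D}_1^w)_{j,j}=0$. Put ${\bf D}_1={\bf I}_{N_z}\otimes{\bf I}_{N_y}\otimes{\bf D}_1^x$, ${\bf D}_2={\bf I}_{N_z}\otimes{\bf D}_1^y\otimes{\bf I}_{N_x}$, ${\bf D}_3={\bf D}_1^z\otimes{\bf I}_{N_y}\otimes{\bf I}_{N_x}$ ($\otimes$ the Kronecker product), acting on grid functions $U_{j,k,m}$ ordered as vectors in $\mathbb R^{s_1}$ with $j$ varying fastest, then $k$, then $m$. Let $${\bf D}=\begin{pmatrix}0&-{\bf D}_3&{\bf D}_2\\ {\bf D}_3&0&-{\bf D}_1\\ -{\bf D}_2&{\bf D}_1&0\end{pmatrix},\qquad \hat{\bf D}={\bf D}+\frac{c^2\tau^2}{12}{\bf D}^3+\frac{c^4\tau^4}{120}{\bf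 D}^5 .$$ Unknowns ${\bf H}^n=(({\bf H}_x^n)^T,({\bf H}_y^n)^T,({\bf H}_z^n)^T)^T$ and ${\bf E}^n=(({\bf E}_x^n)^T,({\bf E}_y^n)^T,({\bf E}_z^n)^T)^T$ lie in $\mathbb R^{3s_1}$. The differentials $dE_{w_{j,k,m}}^n,dH_{w_{j,k,m}}^n$ are those of the numerical solution at time level $n$ regarded as functions of the initial data $({\bf H}^0,{\bf E}^0)\in\mathbb R^{6s_1}$. *)

(* Defs.v *)
From mathcomp Require Import all_boot all_order all_algebra.
From mathcomp Require Import all_classical all_reals all_analysis.
From mathcomp Require Export mxtens.

Set Implicit Arguments.
Unset Strict Implicit.
Unset Printing Implicit Defensive.

Import Order.TTheory GRing.Theory Num.Theory.
Import numFieldNormedType.Exports.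

Local Open Scope ring_scope.

Section FourierDifferentiation.
Context {R : realType}.
Variables (N : nat) (wL wR : R).

Definition cot (x : R) : R := cos x / sin x.

Definition mesh : R := (wR - wL) / N%:R.
Definition freq : R := 2 * pi / (wR - wL).

(* Nodes are numbered from 0 here: [node j] is w_{j+1} = w_L + j h_w.  The
   shift leaves the sign (-1)^(j+l) below unchanged. *)
Definition node (j : 'I_N) : R := wL + j%:R * mesh.

Definition fourierD1 : 'M[R]_N := \matrix_(j, l)
  if j == l then 0
  else 2^-1 * freq * (-1) ^+ (j + l) * cot (freq * ((node j - node l) / 2)).

End FourierDifferentiation.

(* A scalar grid function U_{j,k,m} is a vector of size Nz * Ny * Nx (= s_1).
   [mxtens_index (a, b)] has value a * p + b for b < p, so the x-index j varies
   fastest, then k, then m; [*t] is the matching Kronecker product. *)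
Definition gridsize (Nx Ny Nz : nat) : nat := (Nz * Ny * Nx)%N.

Definition grid_index (Nx Ny Nz : nat) (j : 'I_Nx) (k : 'I_Ny) (m : 'I_Nz) :
  'I_(gridsize Nx Ny Nz) := mxtens_index (mxtens_index (m, k), j).

Section Operators.
Context {R : realType}.
Variables (Nx Ny Nz : nat) (xL xR yL yR zL zR : R).

Local Notation s := (gridsize Nx Ny Nz).

Definition D1 : 'M[R]_s :=
  (1%:M : 'M[R]_Nz) *t (1%:M : 'M[R]_Ny) *t fourierD1 Nx xL xR.
Definition D2 : 'M[R]_s :=
  (1%:M : 'M[R]_Nz) *t fourierD1 Ny yL yR *t (1%:M : 'M[R]_Nx).
Definition D3 : 'M[R]_s :=
  fourierD1 Nz zL zR *t (1%:M : 'M[R]_Ny) *t (1%:M : 'M[R]_Nx).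

Definition Dcurl : 'M[R]_(s + (s + s)) :=
  col_mx (row_mx 0     (row_mx (- D3) D2))
 (col_mx (row_mx D3    (row_mx 0      (- D1)))
         (row_mx (- D2) (row_mx D1     0))).

Definition Dhat (c tau : R) : 'M[R]_(s + (s + s)) :=
  Dcurl + (c ^+ 2 * tau ^+ 2 / 12) *: Dcurl ^+ 3
        + (c ^+ 4 * tau ^+ 4 / 120) *: Dcurl ^+ 5.

End Operators.

(* (H^n, E^n) for n <= M, started at z = (H^0, E^0); values for n > M are
   unconstrained. *)
Definition scheme_solution (R : realType) (d : nat) (A : 'M[R]_d)
    (mu eps tau : R) (M : nat) (z : 'cV[R]_d * 'cV[R]_d)
    (H E : nat -> 'cV[R]_d) : Prop :=
  [/\ H 0%N = z.1, E 0%N = z.2 &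
      forall n, (n < M)%N ->
        mu *: (tau^-1 *: (H n.+1 - H n)) = - (A *m (2^-1 *: (E n.+1 + E n))) /\
        eps *: (tau^-1 *: (E n.+1 - E n)) = A *m (2^-1 *: (H n.+1 + H n))].

Definition xcomp {R : realType} {s : nat} (U : 'cV[R]_(s + (s + s))) : 'cV[R]_s :=
  usubmx U.
Definition ycomp {R : realType} {s : nat} (U : 'cV[R]_(s + (s + s))) : 'cV[R]_s :=
  usubmx (dsubmx U).
Definition zcomp {R : realType} {s : nat} (U : 'cV[R]_(s + (s + s))) : 'cV[R]_s :=
  dsubmx (dsubmx U).

Definition wedge {R : realType} {V : Type} (a b : V -> R) (u v : V) : R :=
  a u * b v - a v * b u.

Section SymplecticForm.
Context {R : realType} {V : normedModType R}.
Variables (Nx Ny Nz : nat).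

Local Notation s := (gridsize Nx Ny Nz).

(* d(Ew) /\ d(Hw) at the point z, for one component of each field *)
Definition wedge_comp (Ew Hw : V -> 'cV[R]_s) (z : V) (u v : V) : R :=
  \sum_(j < Nx) \sum_(k < Ny) \sum_(m < Nz)
    wedge ('d (fun p : V => Ew p (grid_index j k m) 0 : R^o) z)
          ('d (fun p : V => Hw p (grid_index j k m) 0 : R^o) z) u v.

Definition omega (E H : V -> 'cV[R]_(s + (s + s))) (z : V) (u v : V) : R :=
    wedge_comp (xcomp \o E) (xcomp \o H) z u v
  + wedge_comp (ycomp \o E) (ycomp \o H) z u v
  + wedge_comp (zcomp \o E) (zcomp \o H) z u v.

End SymplecticForm.

(* Main.v *)
Require Import Defs.
From HB Require Import structures.
From mathcomp Require Import all_boot all_order all_algebra.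
From mathcomp Require Import all_classical all_reals all_analysis.
From mathcomp Require Import ring lra.
Import Order.TTheory GRing.Theory Num.Theory.
Import numFieldNormedType.Exports.
Local Open Scope ring_scope.

Set Implicit Arguments.
Unset Strict Implicit.

(** The Fourier differentiation matrices are antisymmetric, because the
    cotangent is odd.  The discrete curl is antisymmetric both as a block
    pattern and in each of its entries, hence symmetric, and so is every
    polynomial in it, in particular the sixth-order corrected operator
    ([Dhat_sym]).  From here on only the symmetry of A is used.

    In one step, (H, E) moves by (- p A (E1 + E), q A (H1 + H)) with p, q > 0.
    Pairing the two equations with the new fields shows that a step from
    (0, 0) can only reach (0, 0), as a positive combination of |H1|^2 and |E1|^2
    vanishes ([midpoint_step_from0]).  A step is a linear relation, so its end is
    determined by its start and depends linearly on it, and the numerical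
    solution is linear in the initial data ([scheme_solution_linear]).  On a finite dimensional space a linear map
    is differentiable and is its own differential, so the differentials of
    the fields at level n are these fields themselves, started from the
    tangent vectors u and v, and
      omega^n (u, v) = <E^n u, H^n v> - <E^n v, H^n u>.

    For two solutions (H, E) and (H', E') the increment of <E, H'> is half of
      <E1 - E, H1' + H'> + <E1 + E, H1' - H'>
        = q <A (H1 + H), H1' + H'> - p <E1 + E, A (E1' + E')>,
    which does not change when the two solutions are exchanged, since A is
    symmetric; the increment of the antisymmetrized expression omega is thus
    zero ([midpoint_step_symplectic]). *)

(** * Symmetry of the corrected discrete curl *)

Lemma cotN (R : realType) (x : R) : cot (- x) = - cot x.
Proof. by rewrite /cot cosN sinN invrN mulrN. Qed.

Lemma fourierD1_antisym (R : realType) (N : nat) (wL wR : R) :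
  (fourierD1 N wL wR)^T = - fourierD1 N wL wR.
Proof.
apply/matrixP => i j; rewrite !mxE eq_sym; case: eqP => _; first by rewrite oppr0.
by rewrite addnC -opprB mulNr mulrN cotN mulrN.
Qed.

Lemma tensNmx (R : pzRingType) (m n p q : nat) (A : 'M[R]_(m, n))
  (B : 'M[R]_(p, q)) : (- A) *t B = - (A *t B).
Proof. by apply/matrixP => i j; rewrite !mxE mulNr. Qed.

Lemma tensmxN (R : pzRingType) (m n p q : nat) (A : 'M[R]_(m, n))
  (B : 'M[R]_(p, q)) : A *t (- B) = - (A *t B).
Proof. by apply/matrixP => i j; rewrite !mxE mulrN. Qed.

Lemma trmx_exp (R : comPzRingType) (n : nat) (A : 'M[R]_n) (k : nat) :
  (A ^+ k)^T = A^T ^+ k.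
Proof.
elim: k => [|k IHk]; first by rewrite !expr0 trmx1.
by rewrite exprS exprSr trmx_mul IHk.
Qed.

Section Symmetry.
Context {R : realType}.
Variables (Nx Ny Nz : nat) (xL xR yL yR zL zR : R).

Lemma D1_antisym : (D1 Nx Ny Nz xL xR)^T = - D1 Nx Ny Nz xL xR.
Proof. by rewrite /D1 !trmx_tens !trmx1 fourierD1_antisym tensmxN. Qed.

Lemma D2_antisym : (D2 Nx Ny Nz yL yR)^T = - D2 Nx Ny Nz yL yR.
Proof. by rewrite /D2 !trmx_tens !trmx1 fourierD1_antisym tensmxN tensNmx. Qed.

Lemma D3_antisym : (D3 Nx Ny Nz zL zR)^T = - D3 Nx Ny Nz zL zR.
Proof. by rewrite /D3 !trmx_tens !trmx1 fourierD1_antisym !tensNmx. Qed.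

Lemma Dcurl_sym :
  (Dcurl Nx Ny Nz xL xR yL yR zL zR)^T = Dcurl Nx Ny Nz xL xR yL yR zL zR.
Proof.
rewrite /Dcurl.
set d1 := D1 _ _ _ _ _; set d2 := D2 _ _ _ _ _; set d3 := D3 _ _ _ _ _.
(* regrouping the lower two block rows by columns exposes a 2 x 2 block matrix *)
have -> : col_mx (row_mx d3 (row_mx 0 (- d1))) (row_mx (- d2) (row_mx d1 0))
  = row_mx (col_mx d3 (- d2)) (block_mx 0 (- d1) d1 0) by rewrite -block_mxEh.
rewrite -/(block_mx _ _ _ _) !tr_block_mx tr_row_mx tr_col_mx !linearN /= !trmx0.
by rewrite D1_antisym D2_antisym D3_antisym !opprK.
Qed.

Lemma Dhat_sym (c tau : R) :
  (Dhat Nx Ny Nz xL xR yL yR zL zR c tau)^T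
  = Dhat Nx Ny Nz xL xR yL yR zL zR c tau.
Proof. by rewrite /Dhat !linearD !linearZ /= !trmx_exp Dcurl_sym. Qed.

End Symmetry.

(** * The Euclidean pairing *)

Definition dot (R : realType) (d : nat) (u v : 'cV[R]_d) : R :=
  \sum_i u i 0 * v i 0.

Section Dot.
Context {R : realType} {d : nat}.
Implicit Types u v w : 'cV[R]_d.

Lemma dotC u v : dot u v = dot v u.
Proof. by apply: eq_bigr => i _; rewrite mulrC. Qed.

Lemma dotDl u v w : dot (u + v) w = dot u w + dot v w.
Proof. by rewrite -big_split; apply: eq_bigr => i _; rewrite mxE mulrDl. Qed.

Lemma dotZl (a : R) u v : dot (a *: u) v = a * dot u v.
Proof. by rewrite mulr_sumr; apply: eq_bigr => i _; rewrite mxE mulrA. Qed.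

Lemma dotNl u v : dot (- u) v = - dot u v.
Proof. by rewrite -scaleN1r dotZl mulN1r. Qed.

Lemma dotDr u v w : dot u (v + w) = dot u v + dot u w.
Proof. by rewrite dotC dotDl !(dotC _ u). Qed.

Lemma dotNr u v : dot u (- v) = - dot u v.
Proof. by rewrite dotC dotNl dotC. Qed.

Lemma dotZr (a : R) u v : dot u (a *: v) = a * dot u v.
Proof. by rewrite dotC dotZl dotC. Qed.

Lemma dot_ge0 u : 0 <= dot u u.
Proof. by apply: sumr_ge0 => i _; rewrite -expr2 sqr_ge0. Qed.

Lemma dot_eq0 u : dot u u = 0 -> u = 0.
Proof.
move=> /eqP; rewrite psumr_eq0 => [/allP u0|i _]; last by rewrite -expr2 sqr_ge0.
apply/matrixP => i j; rewrite ord1 mxE.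
by have := u0 i (mem_index_enum i); rewrite /= mulf_eq0 orbb => /eqP.
Qed.

Lemma dot_mulmxl (A : 'M[R]_d) u v : dot (A *m u) v = dot u (A^T *m v).
Proof.
rewrite /dot; under eq_bigr => i _ do rewrite mxE mulr_suml.
under [RHS]eq_bigr => i _ do rewrite mxE mulr_sumr.
rewrite exchange_big; apply: eq_bigr => j _; apply: eq_bigr => i _.
by rewrite mxE mulrCA mulrA.
Qed.

End Dot.

(** * One step of the midpoint scheme with a symmetric operator *)

Section MidpointStep.
Context {R : realType} {d : nat}.
Variables (A : 'M[R]_d) (p q : R).
Hypotheses (Asym : A^T = A) (p0 : 0 < p) (q0 : 0 < q).
Implicit Types h e : 'cV[R]_d.

(** The scheme solved for the increments: p = tau / (2 mu), q = tau / (2 eps).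
    The steps are kept as a relation, which avoids inverting 1 + p q A^2. *)
Definition midpoint_step h e h1 e1 : Prop :=
  h1 - h = - (p *: (A *m (e1 + e))) /\ e1 - e = q *: (A *m (h1 + h)).

Lemma midpoint_step_linear (a : R) h e h1 e1 h' e' h1' e1' :
  midpoint_step h e h1 e1 -> midpoint_step h' e' h1' e1' ->
  midpoint_step (a *: h + h') (a *: e + e') (a *: h1 + h1') (a *: e1 + e1').
Proof.
have regroup (x1 x y1 y : 'cV[R]_d) :
    (a *: x1 + y1) - (a *: x + y) = a *: (x1 - x) + (y1 - y)
  by rewrite scalerBr opprD addrACA.
have regroupD (x1 x y1 y : 'cV[R]_d) :
    (a *: x1 + y1) + (a *: x + y) = a *: (x1 + x) + (y1 + y)
  by rewrite scalerDr addrACA.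
move=> [sh se] [sh' se']; split; rewrite regroup regroupD.
  by rewrite sh sh' [in RHS]mulmxDr -scalemxAr scalerDr opprD scalerN !scalerA mulrC.
by rewrite se se' [in RHS]mulmxDr -scalemxAr scalerDr !scalerA mulrC.
Qed.

(** The cross terms of the two equations, paired with [h1] and [e1], cancel by
    symmetry of [A]: this is conservation of the discrete energy. *)
Lemma midpoint_step_from0 h1 e1 :
  midpoint_step 0 0 h1 e1 -> h1 = 0 /\ e1 = 0.
Proof.
move=> []; rewrite !subr0 !addr0 => sh se.
have energy : q * dot h1 h1 + p * dot e1 e1 = 0.
  have -> : dot h1 h1 = - (p * dot (A *m e1) h1) by rewrite {1}sh dotNl dotZl.
  have -> : dot e1 e1 = q * dot (A *m e1) h1.
    by rewrite {1}se dotZl dot_mulmxl Asym dotC.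
  by ring.
move/eqP: energy; rewrite paddr_eq0 ?(mulr_ge0 (ltW _)) ?dot_ge0 //.
rewrite !mulf_eq0 (gt_eqF p0) (gt_eqF q0) /= => /andP[/eqP hh /eqP ee].
by split; apply: dot_eq0.
Qed.

(** The increment of [dot e h'] is symmetric in the two solutions, hence that of
    its antisymmetrization vanishes. *)
Lemma midpoint_step_symplectic h e h1 e1 h' e' h1' e1' :
  midpoint_step h e h1 e1 -> midpoint_step h' e' h1' e1' ->
  dot e1 h1' - dot e1' h1 = dot e h' - dot e' h.
Proof.
have increment (x x1 y y1 : 'cV[R]_d) : dot x1 y1 - dot x y
    = 2^-1 * (dot (x1 - x) (y1 + y) + dot (x1 + x) (y1 - y)).
  by rewrite !dotDl !dotDr !dotNl !dotNr; field.
move=> [sh se] [sh' se'].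
have := increment e e1 h' h1'; have := increment e' e1' h h1.
have Adot u v : dot (A *m u) v = dot u (A *m v) by rewrite dot_mulmxl Asym.
rewrite sh se sh' se' !dotNr !dotZl !dotZr.
rewrite -(Adot (e1 + e)) (dotC (A *m (e1 + e))).
rewrite (Adot (h1 + h)) (dotC (h1 + h)).
lra.
Qed.

End MidpointStep.

Lemma scheme_solution_step (R : realType) (d : nat) (A : 'M[R]_d)
    (mu eps tau : R) (M : nat) (z : 'cV[R]_d * 'cV[R]_d) (H E : nat -> 'cV[R]_d) :
  0 < mu -> 0 < eps -> 0 < tau -> scheme_solution A mu eps tau M z H E ->
  forall n, (n < M)%N ->
  midpoint_step A (tau / mu / 2) (tau / eps / 2) (H n) (E n) (H n.+1) (E n.+1).
Proof.
move=> mu0 eps0 tau0 [_ _ step] n nM; have [sh se] := step n nM.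
have isolate (k : R) (x y : 'cV[R]_d) : 0 < k ->
    k *: (tau^-1 *: x) = A *m (2^-1 *: y) -> x = (tau / k / 2) *: (A *m y).
  move=> k0 /(congr1 ( *:%R (tau / k))); rewrite -scalemxAr !scalerA.
  by rewrite divfK ?mulfV ?scale1r // gt_eqF.
split; last exact: isolate.
rewrite -scalerN -mulmxN; apply: isolate => //.
by rewrite sh scalerN mulmxN.
Qed.

(** The relation between data and solution is linear and a step from zero data
    stays at zero, so the step commutes with linear combinations of data. *)
Lemma scheme_solution_linear (R : realType) (d : nat) (A : 'M[R]_d)
    (mu eps tau : R) (M : nat)
    (H E : nat -> 'cV[R]_d * 'cV[R]_d -> 'cV[R]_d) :
  A^T = A -> 0 < mu -> 0 < eps -> 0 < tau ->
  (forall z, scheme_solution A mu eps tau M z (H^~ z) (E^~ z)) ->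
  forall n, (n <= M)%N -> linear (H n) /\ linear (E n).
Proof.
move=> Asym mu0 eps0 tau0 sol.
elim=> [_|n IHn nM].
  by split=> a u v; have [H0 E0 _] := sol u; have [H0' E0' _] := sol v;
    have [H0s E0s _] := sol (a *: u + v); rewrite ?H0s ?H0 ?H0' ?E0s ?E0 ?E0'.
have [linH linE] := IHn (ltnW nM).
have step z := @scheme_solution_step _ _ _ _ _ _ _ _ _ _ mu0 eps0 tau0 (sol z) n nM.
have p0 (k : R) : 0 < k -> 0 < tau / k / 2 by move=> k0; rewrite !divr_gt0.
suff lin a u v : H n.+1 (a *: u + v) = a *: H n.+1 u + H n.+1 v /\
                 E n.+1 (a *: u + v) = a *: E n.+1 u + E n.+1 v.
  by split=> a u v; have [] := lin a u v.
(* linH and linE make this combination of three steps start from zero; it ends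
   at the defect of linearity at level n + 1 *)
have defect := midpoint_step_linear (-1)
  (midpoint_step_linear a (step u) (step v)) (step (a *: u + v)).
rewrite linH linE !scaleN1r !addNr in defect.
have [/eqP + /eqP] :=
  midpoint_step_from0 Asym (p0 _ mu0) (p0 _ eps0) defect.
by rewrite ![- _ + _]addrC !subr_eq0 => /eqP -> /eqP ->.
Qed.

(** * Differentials of linear maps and the symplectic form *)

Lemma linear_cV_sum (R : pzRingType) (d : nat) (W : lmodType R)
    (g : 'cV[R]_d -> W) (x : 'cV[R]_d) :
  linear g -> g x = \sum_(i < d) x i 0 *: g (delta_mx i 0).
Proof.
move=> ling.
pose G : {linear 'cV[R]_d -> W} :=
  HB.pack g (GRing.isLinear.Build _ _ _ _ _ ling).
rewrite -[g x]/(G x) [in LHS](matrix_sum_delta x) linear_sum.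
by apply: eq_bigr => i _; rewrite big_ord1 linearZ.
Qed.

(** A linear map on pairs of vectors is a finite combination of coordinates with
    constant vector coefficients, and coordinates are differentiable. *)
Lemma linear_differentiable_cV (R : realType) (d : nat) (W : normedModType R)
    (f : 'cV[R]_d * 'cV[R]_d -> W) (z : 'cV[R]_d * 'cV[R]_d) :
  linear f -> differentiable f z.
Proof.
move=> linf.
have lin1 : linear (fun x => f (x, 0)).
  by move=> a x y; rewrite -linf; congr f; congr pair; rewrite /= scaler0 addr0.
have lin2 : linear (fun x => f (0, x)).
  by move=> a x y; rewrite -linf; congr f; congr pair; rewrite /= scaler0 addr0.
pose c1 i : 'cV[R]_d * 'cV[R]_d -> R := fun y => y.1 i 0.
pose c2 i : 'cV[R]_d * 'cV[R]_d -> R := fun y => y.2 i 0.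
have dc1 i : differentiable (c1 i) z.
  apply: (@differentiable_comp _ _ _ _ fst (fun x : 'cV[R]_d => x i 0)).
    by apply: linear_differentiable => y; exact: cvg_fst.
  exact: differentiable_coord.
have dc2 i : differentiable (c2 i) z.
  apply: (@differentiable_comp _ _ _ _ snd (fun x : 'cV[R]_d => x i 0)).
    by apply: linear_differentiable => y; exact: cvg_snd.
  exact: differentiable_coord.
have -> : f = \sum_(i < d) (fun y => c1 i y *: f (delta_mx i 0, 0))
            + \sum_(i < d) (fun y => c2 i y *: f (0, delta_mx i 0)).
  apply/funext => -[a b]; rewrite fctE !fct_sumE /c1 /c2 /=.
  rewrite -(linear_cV_sum a lin1) -(linear_cV_sum b lin2) -[f (a, 0)]scale1r -linf.
  by congr f; congr pair; rewrite /= scale1r ?addr0 ?add0r.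
by apply: differentiableD; apply: differentiable_sum => i; exact: differentiableZl.
Qed.

Lemma diff_linear_cV (R : realType) (d : nat) (W : normedModType R)
    (f : 'cV[R]_d * 'cV[R]_d -> W) (z : 'cV[R]_d * 'cV[R]_d) :
  linear f -> 'd f z = f :> (_ -> _).
Proof.
move=> linf.
pose F : {linear ('cV[R]_d * 'cV[R]_d)%type -> W} :=
  HB.pack f (GRing.isLinear.Build _ _ _ _ _ linf).
apply: (@diff_lin _ _ _ F) => y.
exact/differentiable_continuous/linear_differentiable_cV.
Qed.

Lemma sum_grid (V : nmodType) (Nx Ny Nz : nat)
    (f : 'I_(gridsize Nx Ny Nz) -> V) :
  \sum_(j < Nx) \sum_(k < Ny) \sum_(m < Nz) f (grid_index j k m) = \sum_i f i.
Proof.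
have sum_tens a b (g : 'I_(a * b) -> V) :
    \sum_i g i = \sum_(j < b) \sum_(i < a) g (mxtens_index (i, j)).
  rewrite exchange_big pair_bigA (reindex (@mxtens_index a b)) /=.
    by apply: eq_bigr => -[].
  by exists (@mxtens_unindex a b) => ? _; rewrite (mxtens_indexK, mxtens_unindexK).
rewrite sum_tens; apply: eq_bigr => j _.
by rewrite sum_tens.
Qed.

(** The triple sums over the grid, one for each component of the fields, together
    run once through all coordinates, so they assemble into two pairings. *)
Lemma omega_linear (R : realType) (Nx Ny Nz : nat) :
  let s := gridsize Nx Ny Nz in
  let V := ('cV[R]_(s + (s + s)) * 'cV[R]_(s + (s + s)))%type in
  forall (E H : V -> 'cV[R]_(s + (s + s))), linear E -> linear H ->
  forall z u v : V, omega E H z u v = dot (E u) (H v) - dot (E v) (H u).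
Proof.
move=> s V E H linE linH z u v.
have coord_linear (i : 'I_(s + (s + s))) (f : V -> 'cV[R]_(s + (s + s))) :
    linear f -> linear (fun x => f x i 0 : R^o).
  by move=> linf a x y; rewrite linf !mxE.
have component (pr : 'I_s -> 'I_(s + (s + s)))
    (comp : 'cV[R]_(s + (s + s)) -> 'cV[R]_s) :
    (forall U i, comp U i 0 = U (pr i) 0) ->
    wedge_comp (comp \o E) (comp \o H) z u v
    = \sum_i (E u (pr i) 0 * H v (pr i) 0 - E v (pr i) 0 * H u (pr i) 0).
  move=> compE; rewrite -sum_grid /wedge_comp.
  apply: eq_bigr => j _; apply: eq_bigr => k _; apply: eq_bigr => m _.
  have fE (f : V -> 'cV[R]_(s + (s + s))) :
      (fun x => (comp \o f) x (grid_index j k m) 0 : R^o)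
      = (fun x => f x (pr (grid_index j k m)) 0 : R^o).
    by apply/funext => x /=; rewrite compE.
  by rewrite /wedge !fE !diff_linear_cV //; exact: coord_linear.
rewrite /dot -sumrB !big_split_ord /= addrA /omega.
congr (_ + _ + _); apply: component => U i; by rewrite !mxE.
Qed.

Theorem theorem4p1 (R : realType) (Nx Ny Nz : nat)
  (hNx : (0 < Nx)%N) (eNx : ~~ odd Nx)
  (hNy : (0 < Ny)%N) (eNy : ~~ odd Ny)
  (hNz : (0 < Nz)%N) (eNz : ~~ odd Nz)
  (xL xR yL yR zL zR : R) (hx : xL < xR) (hy : yL < yR) (hz : zL < zR)
  (T : R) (hT : 0 < T) (M : nat) (hM : (0 < M)%N)
  (eps mu : R) (heps : 0 < eps) (hmu : 0 < mu) :
  let s := gridsize Nx Ny Nz in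
  let V := ('cV[R]_(s + (s + s)) * 'cV[R]_(s + (s + s)))%type in
  let tau := T / M%:R in
  let c := 1 / Num.sqrt (eps * mu) in
  let A := Dhat Nx Ny Nz xL xR yL yR zL zR c tau in
  forall H E : nat -> V -> 'cV[R]_(s + (s + s)),
  (forall z : V,
     scheme_solution A mu eps tau M z (fun n => H n z) (fun n => E n z)) ->
  (forall n, (n <= M)%N ->
     forall z : V, differentiable (H n) z /\ differentiable (E n) z) /\
  (forall n, (n < M)%N -> omega (E n.+1) (H n.+1) = omega (E n) (H n)).
Proof.
move=> s V tau c A H E sol.
have tau0 : 0 < tau by rewrite divr_gt0 ?ltr0n.
have Asym : A^T = A by exact: Dhat_sym.
have lin := scheme_solution_linear Asym hmu heps tau0 sol.
split=> [n nM z|n nM].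
  by have [linH linE] := lin n nM; split; exact: linear_differentiable_cV.
have [linH linE] := lin n (ltnW nM); have [linH1 linE1] := lin n.+1 nM.
apply/funext => z; apply/funext => u; apply/funext => v.
rewrite !omega_linear //.
have step w := @scheme_solution_step _ _ _ _ _ _ _ _ _ _ hmu heps tau0 (sol w) n nM.
exact: midpoint_step_symplectic Asym _ _ _ _ _ _ _ _ (step u) (step v).
Qed.
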